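(* Let $\Delta^+$ be an $\omega$-adapted positive system of $\mathfrak g$ with sign $\varepsilon\in\{\pm1\}$ and let $(M,\langle\cdot,\cdot\rangle_M)$ be a unitary highest weight representation of $\mathfrak g$ (with respect to $\omega$). Then, with respect to the Hermitian form on $M\otimes M(\mathfrak g_{\bar1})$, the relative Dirac operator $\mathrm D$ satisfies $$\mathrm D^{*}=-\varepsilon\,\mathrm D .$$ In particular, $\mathrm D$ is selfadjoint if $\varepsilon=-1$ and skewadjoint if $\varepsilon=+1$. Consequently, $\mathrm D^2$ is positive semidefinite if $\varepsilon=-1$ and negative semidefinite if $\varepsilon=+1$.
   Context: Lie superalgebra. $\mathfrak g=\mathfrak g_{\bar0}\oplus\mathfrak g_{\bar1}$ is one of the complex Lie superalgebras $\mathfrak{sl}(m|n)$ ($m,n\ge1$, $m\neq n$), $\mathfrak{gl}(n|n)$ ($n\ge1$), $\mathfrak{osp}(m|2n)$ ($m,n\ge1$), or the exceptional $F(4)$ ($\mathfrak g_{\bar0}=\mathfrak{so}(7)\oplus\mathfrak{sl}(2)$, $\mathfrak g_{\bar1}=$ spin $\otimes\,\mathbb C^2$). The invariant form $(X,Y)$ is $\mathrm{str}(XY)$ for $\mathfrak{sl},\mathfrak{gl}$, $\frac12\mathrm{str}(XY)$ for $\mathfrak{osp}$, $\frac16\mathrm{str}_{\mathfrak g}(\mathrm{ad}X\,\mathrm{ad}Y)$ for $F(4)$, and $B=\frac12(\cdot,\cdot)$. With $\Omega_n=\begin{pmatrix}0&I_n\\-I_n&0\end{pmatrix}$, $\mathfrak{osp}(m|2n)$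 consists of the block matrices $\begin{pmatrix}A&B\\C&D\end{pmatrix}\in\mathfrak{gl}(m|2n)$ with $A=-A^T$, $D=\Omega_nD^T\Omega_n$, $C=-\Omega_nB^T$. Cartan subalgebra $\mathfrak h\subseteq\mathfrak g_{\bar0}$: diagonal matrices for $\mathfrak{sl},\mathfrak{gl}$, with coordinates $\epsilon_i$ (entry $i\leq m$), $\delta_a$ (entry $m+a$); for $\mathfrak{osp}(m|2n)$, $r=\lfloor m/2\rfloor$, the matrices $H=\mathrm{diag}(t_1K,\dots,t_rK,0_{m-2r},i\Omega_n\mathrm{diag}(D,D))$ with $K=\begin{pmatrix}0&i\\-i&0\end{pmatrix}$, $D=\mathrm{diag}(d_1,\dots,d_n)$, $\epsilon_i(H)=t_i$, $\delta_a(H)=d_a$; for $F(4)$ the complexification of a Cartan subalgebra of a maximal compact subalgebra of the even real form below. Fixed even positive system $\Delta_{\bar0}^+$: $\{\epsilon_i-\epsilon_j,\delta_a-\delta_b:i<j,a<b\}$ for $\mathfrak{sl},\mathfrak{gl}$; $\{\delta_a\pm\delta_b\ (a<b),2\delta_a,\epsilon_i\pm\epsilon_j\ (i<j)\}$, plus $\{\epsilon_i\}$ if $m$ is odd, for $\mathfrak{osp}$; $\{\delta,\epsilon_i,\epsilon_i\pm\epsilon_j\ (i<j)\}$ for $F(4)$. A positive system $\Delta^+=\Delta_{\bar0}^+\sqcup\Delta_{\bar1}^+$ extends this; $\mathfrak n_{\bar1}^\pm=\bigoplus_{\alpha\in\Delta_{\bar1}^+}\mathfrak g^{\pm\alpha}$.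 Real forms. $\omega$ is a conjugate-linear anti-involution of $\mathfrak g$ (parity preserving, $\omega^2=\mathrm{id}$, $\omega([X,Y])=[\omega(Y),\omega(X)]$) of one of these types: $\omega(X)=J^{-1}\overline X^{\,t}J$ with $J=\mathrm{diag}(I_p,-I_q,\pm I_n)$, $p+q=m$, for $\mathfrak{sl},\mathfrak{gl}$; $J=\mathrm{diag}(\pm I_m,i\Omega_n)$ for $\mathfrak{osp}(m|2n)$, or, if $m=2r$, $J=\mathrm{diag}(i\bigoplus_{i=1}^r\Omega_1,\pm I_{2n})$; for $F(4)$, an anti-involution defining a real form with even part $\mathfrak{so}(7)\oplus\mathfrak{sl}(2,\mathbb R)$ or $\mathfrak{so}(2,5)\oplus\mathfrak{su}(2)$ (the even real form is $\{X\in\mathfrak g_{\bar0}:\omega(X)=-X\}$). $\Delta^+$ is $\omega$-adapted with sign $\varepsilon$ if there are bases $\{\partial_i\}_{i=1}^N$ of $\mathfrak n_{\bar1}^+$ and $\{x_i\}_{i=1}^N$ of $\mathfrak n_{\bar1}^-$ with $(\partial_i,x_j)=\delta_{ij}$ and $\omega(x_i)=\varepsilon\partial_i$ for all $i,j$. A $\mathfrak g$-representation $M$ is unitary if it carries a positive definite Hermitian form with $\langle M_{\bar0},M_{\bar1}\rangle=0$ and $\langle Xv,w\rangle=\langle v,\omega(X)w\rangle$. Dirac operator. Fix such adapted bases (so $B(\partial_i,x_j)=\frac12\delta_{ij}$). The Weyl algebra $\mathscr W(\mathfrak g_{\bar1})$ is the algebra of polynomial differential operators in $x_1,\dots,x_N$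 with $\partial_i=\partial/\partial x_i$; $M(\mathfrak g_{\bar1})=\mathbb C[x_1,\dots,x_N]$ is the oscillator module, with Bargmann–Fock form $\langle\prod x_k^{p_k},\prod x_k^{q_k}\rangle_{M(\mathfrak g_{\bar1})}=\delta_{p,q}\prod p_k!$. $\mathrm D=2\sum_{i=1}^N(\partial_i\otimes x_i-x_i\otimes\partial_i)\in U(\mathfrak g)\otimes\mathscr W(\mathfrak g_{\bar1})$ (ordinary tensor product) acts on $M\otimes M(\mathfrak g_{\bar1})$, which carries the form $\langle v\otimes P,w\otimes Q\rangle=\langle v,w\rangle_M\langle P,Q\rangle_{M(\mathfrak g_{\bar1})}$. $*$ denotes the adjoint with respect to this form, and $T$ is positive (negative) semidefinite if $\langle Tu,u\rangle\ge0$ ($\le0$) for all $u$. *)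

(* Defs.v *)
(* The scalars are an arbitrary C : numClosedFieldType, with conjugation _^*; the
   complex numbers are the instance R[i] with R : realType. *)
From HB Require Import structures.
From mathcomp Require Import all_boot all_order all_algebra.
From mathcomp Require Import finmap.
From mathcomp Require Import mxtens complex sesquilinear.
From mathcomp Require Import monalg mpoly.
From mathcomp Require Import reals.

Set Implicit Arguments.
Unset Strict Implicit.
Unset Printing Implicit Defensive.

Import Order.TTheory GRing.Theory Num.Theory.
Local Open Scope ring_scope.

(* A Lie superalgebra is given as a subset [carrier] of a Z/2-graded ambient vector
   space ([part b] is the projection on the component of parity b, with
   true = odd); bracket and form are only meaningful on [carrier]. *)
Record superLie (C : numClosedFieldType) := SuperLie {
  space :> vectType C;
  part : bool -> space -> space;
  carrier : {pred space};
  br : space -> space -> space;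
  iform : space -> space -> C }.
Arguments carrier {C} s.
Arguments br {C s} X Y : rename.
Arguments part {C s} b X : rename.
Arguments iform {C s} X Y : rename.

Definition hpart (C : numClosedFieldType) (g : superLie C) (b : bool) : {pred g} :=
  [pred X | (X \in carrier g) && (part b X == X)].
Arguments hpart {C} g b.

Section MatrixSuperalgebras.
Variable C : numClosedFieldType.

Section Super.
Variables p q : nat.
Implicit Types X Y : 'M[C]_(p + q).

Definition spart (b : bool) X : 'M[C]_(p + q) :=
  if b then block_mx 0 (ursubmx X) (dlsubmx X) 0
  else block_mx (ulsubmx X) 0 0 (drsubmx X).

Definition supertrace X : C := \tr (ulsubmx X) - \tr (drsubmx X).

Definition scomm X Y : 'M[C]_(p + q) :=
  \sum_(a : bool) \sum_(b : bool)
    (spart a X *m spart b Y - (-1) ^+ (a && b) *: (spart b Y *m spart a X)).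

Definition gl_super : superLie C :=
  @SuperLie C 'M[C]_(p + q) spart predT scomm (fun X Y => supertrace (X *m Y)).

Definition sl_super : superLie C :=
  @SuperLie C 'M[C]_(p + q) spart [pred X | supertrace X == 0] scomm
    (fun X Y => supertrace (X *m Y)).
End Super.

Definition Omega n : 'M[C]_(n + n) := block_mx 0 1%:M (- 1%:M) 0.

Definition osp_super (m n : nat) : superLie C :=
  @SuperLie C 'M[C]_(m + (n + n)) (@spart m (n + n))
    [pred X | [&& ulsubmx X == - (ulsubmx X)^T,
                  drsubmx X == Omega n *m (drsubmx X)^T *m Omega n
                & dlsubmx X == - (Omega n *m (ursubmx X)^T)]]
    (@scomm m (n + n)) (fun X Y => 2%:R^-1 * supertrace (X *m Y)).
End MatrixSuperalgebras.

(* F(4) = (so(7) + sl(2)) + (spin (x) C^2), as triples (A, B, s) where s is an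
   8 x 2 matrix: so(7) acts on the columns of s by the spin representation and
   B acts by s |-> s B^T.  The seven real matrices [gamma i] are antisymmetric,
   anticommute pairwise and square to -1, so the spin representation preserves
   the standard symmetric form of C^8.  Up to rescaling s, the ratio 2 : -3 of
   the two components of the odd bracket is the only one for which the super
   Jacobi identity holds. *)
Section F4.
Variable C : numClosedFieldType.

Definition mx2 (a b c d : C) : 'M[C]_2 :=
  \matrix_(i, j) nth 0 (nth [::] [:: [:: a; b]; [:: c; d]] i) j.
Definition mx2_one := mx2 1 0 0 1.
Definition mx2_e := mx2 0 1 (-1) 0.
Definition mx2_s1 := mx2 0 1 1 0.
Definition mx2_s3 := mx2 1 0 0 (-1).

Definition gamma (i : 'I_7) : 'M[C]_8 :=
  nth 0 [:: mx2_e *t mx2_e *t mx2_e;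
            mx2_one *t mx2_s1 *t mx2_e;
            mx2_one *t mx2_s3 *t mx2_e;
            mx2_s1 *t mx2_e *t mx2_one;
            mx2_s3 *t mx2_e *t mx2_one;
            mx2_e *t mx2_one *t mx2_s1;
            mx2_e *t mx2_one *t mx2_s3] i.

Definition spin (A : 'M[C]_7) : 'M[C]_8 :=
  - (4%:R^-1 *: \sum_i \sum_j A i j *: (gamma i *m gamma j)).

Definition F4_ambient : vectType C := ('M[C]_7 * 'M[C]_2 * 'M[C]_(8, 2))%type.
Implicit Types X Y : F4_ambient.

Definition F4_part (b : bool) X : F4_ambient :=
  if b then (0, 0, X.2) else (X.1, 0).

Definition F4_mem : {pred F4_ambient} :=
  [pred X | (X.1.1^T == - X.1.1) && (\tr X.1.2 == 0)].

Definition odd_so7 (s t : 'M[C]_(8, 2)) : 'M[C]_7 :=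
  \matrix_(i, j) if i == j then 0
                 else \tr (s^T *m (gamma i *m gamma j) *m t *m mx2_e^T).
Definition odd_sl2 (s t : 'M[C]_(8, 2)) : 'M[C]_2 :=
  (s^T *m t + t^T *m s) *m mx2_e.

Definition F4_br X Y : F4_ambient :=
  let: (A, B, s) := X in let: (A', B', t) := Y in
  (A *m A' - A' *m A + 2%:R *: odd_so7 s t,
   B *m B' - B' *m B - 3%:R *: odd_sl2 s t,
   (spin A *m t + t *m B^T) - (spin A' *m s + s *m B'^T)).

(* The supertrace over F(4) itself (not over the ambient space), computed in the
   basis E_ij - E_ji (i < j) of so(7), the standard basis of sl(2) and the
   elementary 8 x 2 matrices. *)
Definition F4_supertrace (T : F4_ambient -> F4_ambient) : C :=
  (\sum_(i < 7) \sum_(j < 7 | (i < j)%N)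
      (T (delta_mx i j - delta_mx j i, 0, 0)).1.1 i j
   + (T (0, delta_mx 0 0 - delta_mx 1 1, 0)).1.2 0 0
   + (T (0, delta_mx 0 1, 0)).1.2 0 1
   + (T (0, delta_mx 1 0, 0)).1.2 1 0)
  - \sum_(i < 8) \sum_(j < 2) (T (0, 0, delta_mx i j)).2 i j.

Definition F4_form X Y : C :=
  6%:R^-1 * F4_supertrace (fun Z => F4_br X (F4_br Y Z)).

Definition F4_super : superLie C :=
  @SuperLie C F4_ambient F4_part F4_mem F4_br F4_form.

Definition F4_so7 : {pred F4_super} := [pred X | (X \in F4_mem) && (X == (X.1.1, 0, 0))].
Definition F4_sl2 : {pred F4_super} := [pred X | (X \in F4_mem) && (X == (0, X.1.2, 0))].
End F4.
Arguments F4_so7 C : clear implicits.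
Arguments F4_sl2 C : clear implicits.

Inductive lsa_kind := SL (m n : nat) | GL (n : nat) | OSP (m n : nat) | F4.

Definition admissible (k : lsa_kind) : bool :=
  match k with
  | SL m n => [&& (0 < m)%N, (0 < n)%N & m != n]
  | GL n => (0 < n)%N
  | OSP m n => (0 < m)%N && (0 < n)%N
  | F4 => true
  end.

Definition lsa (C : numClosedFieldType) (k : lsa_kind) : superLie C :=
  match k with
  | SL m n => sl_super C m n
  | GL n => gl_super C n n
  | OSP m n => osp_super C m n
  | F4 => F4_super C
  end.

Section RealForms.
Variable C : numClosedFieldType.

Definition anti_involution (g : superLie C) (om : g -> g) : Prop :=
  [/\ forall b X, X \in hpart g b -> om X \in hpart g b,
      forall (a : C) X Y, X \in carrier g -> Y \in carrier g ->
        om (a *: X + Y) = a^* *: om X + om Y,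
      forall X, X \in carrier g -> om X \in carrier g /\ om (om X) = X
    & forall X Y, X \in carrier g -> Y \in carrier g -> om (br X Y) = br (om Y) (om X)].

Definition adjmx n (X : 'M[C]_n) : 'M[C]_n := map_mx Num.conj X^T.

Definition I_mx n p : 'M[C]_n := diag_mx (\row_i (-1) ^+ (p <= i)%N).

Definition A_type_om m n (g : {pred 'M[C]_(m + n)})
    (om : 'M[C]_(m + n) -> 'M[C]_(m + n)) : Prop :=
  exists p (s : bool), (p <= m)%N /\
    let J := block_mx (I_mx m p) 0 0 ((-1) ^+ s)%:M in
    forall X, X \in g -> om X = invmx J *m adjmx X *m J.

Lemma odd_ord_subproof m (k : 'I_m./2) : (k.*2.+1 < m)%N.
Proof. by rewrite -gtn_half_double. Qed.
Lemma even_ord_subproof m (k : 'I_m./2) : (k.*2 < m)%N.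
Proof. exact: ltnW (odd_ord_subproof k). Qed.
Definition even_ord m (k : 'I_m./2) : 'I_m := Ordinal (even_ord_subproof k).
Definition odd_ord m (k : 'I_m./2) : 'I_m := Ordinal (odd_ord_subproof k).

(* diag(t_1 Omega_1, .., t_r Omega_1, 0_{m - 2r}) with r = floor(m/2) *)
Definition Omega1_blocks m (t : 'I_m./2 -> C) : 'M[C]_m :=
  \sum_k t k *: (delta_mx (even_ord k) (odd_ord k) - delta_mx (odd_ord k) (even_ord k)).

Definition osp_om m n (om : 'M[C]_(m + (n + n)) -> 'M[C]_(m + (n + n))) : Prop :=
  exists (s : bool) (J : 'M[C]_(m + (n + n))),
    (J = block_mx ((-1) ^+ s)%:M 0 0 ('i *: Omega C n)
     \/ ~~ odd m /\ J = block_mx ('i *: Omega1_blocks (fun _ => 1)) 0 0 ((-1) ^+ s)%:M)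
    /\ forall X, X \in carrier (osp_super C m n) -> om X = invmx J *m adjmx X *m J.

Definition even_real_form (g : superLie C) (om : g -> g) (X : g) : Prop :=
  X \in hpart g false /\ om X = - X.

Definition so_real p n : {pred 'M[C]_n} :=
  [pred A | (A \is a mxOver Num.real) && (A^T *m I_mx n p + I_mx n p *m A == 0)].
Arguments so_real : clear implicits.
Definition sl2_real : {pred 'M[C]_2} :=
  [pred B | (B \is a mxOver Num.real) && (\tr B == 0)].
Definition su2 : {pred 'M[C]_2} :=
  [pred B | (adjmx B == - B) && (\tr B == 0)].

Definition mxcomm n (X Y : 'M[C]_n) := X *m Y - Y *m X.

(* The direct sum S1 + S2 is isomorphic to G as a real Lie algebra. *)
Definition real_iso (g : superLie C) (S1 : {pred 'M[C]_7}) (S2 : {pred 'M[C]_2})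
    (G : g -> Prop) : Prop :=
  exists phi : 'M[C]_7 -> 'M[C]_2 -> g,
  [/\ forall A B, A \in S1 -> B \in S2 -> G (phi A B),
      forall A B A' B', A \in S1 -> B \in S2 -> A' \in S1 -> B' \in S2 ->
        phi A B = phi A' B' -> A = A' /\ B = B',
      forall X, G X -> exists A B, [/\ A \in S1, B \in S2 & X = phi A B],
      forall (a : C) A B A' B', a \is Num.real ->
        A \in S1 -> B \in S2 -> A' \in S1 -> B' \in S2 ->
        phi (a *: A + A') (a *: B + B') = a *: phi A B + phi A' B'
    & forall A B A' B', A \in S1 -> B \in S2 -> A' \in S1 -> B' \in S2 ->
        phi (mxcomm A A') (mxcomm B B') = br (phi A B) (phi A' B')].

Definition F4_om (om : F4_super C -> F4_super C) : Prop :=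
  real_iso (so_real 7 7) sl2_real (even_real_form om)
  \/ real_iso (so_real 2 7) su2 (even_real_form om).

Definition real_form_type (k : lsa_kind) : (lsa C k -> lsa C k) -> Prop :=
  match k return (lsa C k -> lsa C k) -> Prop with
  | SL m n => A_type_om (carrier (sl_super C m n))
  | GL n => A_type_om (carrier (gl_super C n n))
  | OSP m n => @osp_om m n
  | F4 => F4_om
  end.
End RealForms.

Section CompactCartan.
Variables (C : numClosedFieldType) (g : superLie C).
Implicit Types G K t : g -> Prop.

Definition real_subalgebra G K : Prop :=
  [/\ forall X, K X -> G X,
      K 0,
      forall (a : C) X Y, a \is Num.real -> K X -> K Y -> K (a *: X + Y)
    & forall X Y, K X -> K Y -> K (br X Y)].

(* Compactness of K in G means that ad(K) preserves a real inner product on G. *)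
Definition compactly_embedded G K : Prop :=
  real_subalgebra G K /\ exists q : g -> g -> C,
  [/\ forall X Y, G X -> G Y -> q X Y \is Num.real /\ q X Y = q Y X,
      forall (a : C) X Y Z, a \is Num.real -> G X -> G Y -> G Z ->
        q (a *: X + Y) Z = a * q X Z + q Y Z,
      forall X, G X -> X != 0 -> 0 < q X X
    & forall Z X Y, K Z -> G X -> G Y -> q (br Z X) Y + q X (br Z Y) = 0].

Definition maximal_compact G K : Prop :=
  compactly_embedded G K /\
  forall K', compactly_embedded G K' -> (forall X, K X -> K' X) ->
    forall X, K' X -> K X.

Definition abelian_subalgebra K t : Prop :=
  real_subalgebra K t /\ forall X Y, t X -> t Y -> br X Y = 0.

(* For a compact Lie algebra: a maximal abelian subalgebra *)
Definition compact_cartan K t : Prop :=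
  abelian_subalgebra K t /\
  forall t', abelian_subalgebra K t' -> (forall X, t X -> t' X) ->
    forall X, t' X -> t X.

Definition complexification t (X : g) : Prop :=
  exists Y Z, [/\ t Y, t Z & X = Y + 'i *: Z].
End CompactCartan.

(* Functions on h; for roots linearity is automatic. *)
Definition weight (C : numClosedFieldType) (T : Type) (h : T -> Prop) : Type :=
  {H : T | h H} -> C.

Section Weights.
Variables (C : numClosedFieldType) (T : Type) (h : T -> Prop).
Implicit Types a b : weight C h.

Definition res (f : T -> C) : weight C h := fun H => f (sval H).
Definition addw a b : weight C h := fun H => a H + b H.
Definition oppw a : weight C h := fun H => - a H.
Definition subw a b : weight C h := addw a (oppw b).

Definition pos_diff r (e : 'I_r -> weight C h) a : Prop :=
  exists i j : 'I_r, (i < j)%N /\ a = subw (e i) (e j).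
Definition pos_sum r (e : 'I_r -> weight C h) a : Prop :=
  exists i j : 'I_r, (i < j)%N /\ a = addw (e i) (e j).
End Weights.
Arguments res {C T} h f _.

Section Roots.
Variables (C : numClosedFieldType) (g : superLie C) (h : g -> Prop).
Local Notation weight := (weight C h).

Definition root_space (a : weight) (X : g) : Prop :=
  X \in carrier g /\ forall H : {H : g | h H}, br (sval H) X = a H *: X.

Definition root_in (V : {pred g}) (a : weight) : Prop :=
  (exists H, a H != 0) /\ exists2 X, X \in V & X != 0 /\ root_space a X.

Definition positive_system (P : weight -> Prop) : Prop :=
  [/\ forall a, P a -> root_in (carrier g) a,
      forall a, root_in (carrier g) a -> P a \/ P (oppw a),
      forall a, ~ (P a /\ P (oppw a))
    & forall a b, P a -> P b -> root_in (carrier g) (addw a b) -> P (addw a b)].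

Definition extends_even (P0 P : weight -> Prop) : Prop :=
  forall a, P0 a <-> P a /\ root_in (hpart g false) a.

(* n_odd P false = n_1^+ and n_odd P true = n_1^- *)
Definition n_odd (P : weight -> Prop) (opp : bool) (X : g) : Prop :=
  exists s : seq g, X = \sum_(Y <- s) Y /\
    forall Y, Y \in s -> exists a, [/\ P a, root_in (hpart g true) a
      & root_space (if opp then oppw a else a) Y].

Definition is_basis (V : g -> Prop) N (e : 'I_N -> g) : Prop :=
  free [tuple e i | i < N] /\
  forall X, V X <-> X \in <<[tuple e i | i < N]>>%VS.

Definition adapted_bases (om : g -> g) (P : weight -> Prop) (eps : C) N
    (d x : 'I_N -> g) : Prop :=
  [/\ is_basis (n_odd P false) d,
      is_basis (n_odd P true) x,
      forall i j, iform (d i) (x j) = (i == j)%:R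
    & forall i, om (x i) = eps *: d i].
End Roots.
Arguments root_space {C g} h a X.
Arguments root_in {C g} h V a.
Arguments positive_system {C g} h P.
Arguments extends_even {C g} h P0 P.
Arguments adapted_bases {C g} h om P eps {N} d x.

Section EvenPositiveSystems.
Variable C : numClosedFieldType.

Definition diag_eps m n (i : 'I_m) (H : 'M[C]_(m + n)) : C :=
  H (lshift n i) (lshift n i).
Definition diag_del m n (a : 'I_n) (H : 'M[C]_(m + n)) : C :=
  H (rshift m a) (rshift m a).

Definition A_type_setting m n (g : {pred 'M[C]_(m + n)})
    (h : 'M[C]_(m + n) -> Prop) (P0 : weight C h -> Prop) : Prop :=
  (forall X, h X <-> X \in g /\ is_diag_mx X)
  /\ forall a, P0 a <-> pos_diff (fun i => res h (@diag_eps m n i)) a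
                       \/ pos_diff (fun b => res h (@diag_del m n b)) a.

Definition osp_cartan m n (t : 'I_m./2 -> C) (d : 'rV[C]_n) : 'M[C]_(m + (n + n)) :=
  block_mx ('i *: Omega1_blocks t) 0
    0 ('i *: (Omega C n *m block_mx (diag_mx d) 0 0 (diag_mx d))).

(* These read off t_k and d_a from osp_cartan t d. *)
Definition osp_eps m n (k : 'I_m./2) (H : 'M[C]_(m + (n + n))) : C :=
  - 'i * ulsubmx H (even_ord k) (odd_ord k).
Definition osp_del m n (a : 'I_n) (H : 'M[C]_(m + (n + n))) : C :=
  - 'i * drsubmx H (lshift n a) (rshift n a).

Lemma osp_epsE m n t d k : osp_eps k (@osp_cartan m n t d) = t k.
Proof.
rewrite /osp_eps /osp_cartan block_mxKul !mxE summxE (bigD1 k) //= !mxE !eqxx /=.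
have oe (a b : 'I_m./2) : (odd_ord a == even_ord b) = false.
  by apply/eqP => /(congr1 (odd \o val)) /=; rewrite !odd_double.
have ee (a b : 'I_m./2) : (even_ord a == even_ord b) = (a == b).
  by apply/eqP/eqP => [/(congr1 val) /= /double_inj /val_inj|->].
rewrite big1 => [|j jk]; last first.
  by rewrite !mxE [even_ord k == odd_ord j]eq_sym oe ee [k == j]eq_sym (negbTE jk) subrr mulr0.
by rewrite [even_ord k == _]eq_sym oe subr0 mulr1 addr0 mulrA mulNr -expr2 sqrCi opprK mul1r.
Qed.
Lemma osp_delE m n t d a : osp_del a (@osp_cartan m n t d) = d 0 a.
Proof.
rewrite /osp_del /osp_cartan block_mxKdr /Omega mulmx_block !mul0mx !mul1mx !addr0 add0r.
by rewrite mxE block_mxEur mxE eqxx mulr1n mulrA mulNr -expr2 sqrCi opprK mul1r.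
Qed.

Definition osp_setting m n (h : 'M[C]_(m + (n + n)) -> Prop)
    (P0 : weight C h -> Prop) : Prop :=
  (forall X, h X <-> exists t d, X = osp_cartan t d)
  /\ let e k := res h (@osp_eps m n k) in
     let d b := res h (@osp_del m n b) in
     forall a, P0 a <->
       pos_diff d a \/ pos_sum d a \/ (exists b, a = addw (d b) (d b))
       \/ pos_diff e a \/ pos_sum e a \/ (odd m /\ exists k, a = e k).

(* [e] and [d] are standard coordinates on h: the roots of the summand so(7) are
   the +- e_i and +- e_i +- e_j (i < j), those of sl(2) are +- d. *)
Definition F4_setting (om : F4_super C -> F4_super C) (h : F4_super C -> Prop)
    (P0 : weight C h -> Prop) : Prop :=
  (exists K t, [/\ maximal_compact (even_real_form om) K, compact_cartan K t
                 & forall X, h X <-> complexification t X])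
  /\ exists (e : 'I_3 -> weight C h) (d : weight C h),
     let pos_so7 a := (exists i, a = e i) \/ pos_diff e a \/ pos_sum e a in
     [/\ forall a, root_in h (F4_so7 C) a <-> pos_so7 a \/ pos_so7 (oppw a),
         forall a, root_in h (F4_sl2 C) a <-> a = d \/ a = oppw d
       & forall a, P0 a <-> a = d \/ pos_so7 a].

Definition even_setting (k : lsa_kind) :
    forall (om : lsa C k -> lsa C k) (h : lsa C k -> Prop),
      (weight C h -> Prop) -> Prop :=
  match k return forall (om : lsa C k -> lsa C k) (h : lsa C k -> Prop),
      (weight C h -> Prop) -> Prop with
  | SL m n => fun _ => @A_type_setting m n (carrier (sl_super C m n))
  | GL n => fun _ => @A_type_setting n n (carrier (gl_super C n n))
  | OSP m n => fun _ => @osp_setting m n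
  | F4 => F4_setting
  end.
End EvenPositiveSystems.

Section Representations.
Variables (C : numClosedFieldType) (g : superLie C) (M : lmodType C).
Implicit Types rho : g -> {linear M -> M}.

Definition supergrading (M0 M1 : {pred M}) : Prop :=
  [/\ submod_closed M0, submod_closed M1,
      forall v, v \in M0 -> v \in M1 -> v = 0
    & forall v, exists v0 v1, [/\ v0 \in M0, v1 \in M1 & v = v0 + v1]].

Definition is_representation (M0 M1 : {pred M}) rho : Prop :=
  let Mp (b : bool) := if b then M1 else M0 in
  [/\ supergrading M0 M1,
      forall (a : C) X Y v, X \in carrier g -> Y \in carrier g ->
        rho (a *: X + Y) v = a *: rho X v + rho Y v,
      forall b c X v, X \in hpart g b -> v \in Mp c -> rho X v \in Mp (b (+) c)
    & forall b c X Y v, X \in hpart g b -> Y \in hpart g c ->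
        rho (br X Y) v = rho X (rho Y v) - (-1) ^+ (b && c) *: rho Y (rho X v)].

Definition highest_weight (h : g -> Prop) (P : weight C h -> Prop) rho : Prop :=
  exists (v : M) (L : weight C h),
  [/\ v != 0,
      forall a X, P a -> root_space h a X -> rho X v = 0,
      forall H : {H : g | h H}, rho (sval H) v = L H *: v
    & forall S : {pred M}, submod_closed S ->
        (forall X w, X \in carrier g -> w \in S -> rho X w \in S) ->
        v \in S -> forall w, w \in S].

Definition unitary (om : g -> g) (M0 M1 : {pred M}) rho
    (f : {dot M for Num.conj}) : Prop :=
  (forall v w, v \in M0 -> w \in M1 -> f v w = 0)
  /\ forall X v w, X \in carrier g -> f (rho X v) w = f v (rho (om X) w).
End Representations.
Arguments highest_weight {C g M} h P rho.

(* The oscillator module C[x_1, .., x_N] and the tensor product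
   M (x) C[x_1, .., x_N], realized as finitely supported families of vectors of M
   indexed by the monomials. *)
Section Tensor.
Variables (C : numClosedFieldType) (N : nat) (M : lmodType C).
Local Notation oscillator := (mpoly N C).

Definition bargmann_fock (P Q : oscillator) : C :=
  \sum_(m <- msupp P) P@_m * (Q@_m)^* * (\prod_(i < N) (m i)`!)%:R.

Definition tensor : Type := {malg M['X_{1..N}]}.
HB.instance Definition _ := GRing.Zmodule.on tensor.

Definition tcoef (m : 'X_{1..N}) (u : tensor) : M := monalg.mcoeff m u.
Definition tsupp (u : tensor) : {fset 'X_{1..N}} := monalg.msupp u.

Definition tscale (a : C) (u : tensor) : tensor :=
  [malg m in tsupp u => a *: tcoef m u].

Lemma tscaleE a u m : tcoef m (tscale a u) = a *: tcoef m u.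
Proof.
rewrite /tscale /tcoef monalg.mcoeffE /tsupp.
by case: (monalg.msuppP u m); rewrite ?scaler0.
Qed.

Lemma tcoef_is_additive m : {morph tcoef m : u w / u + w}.
Proof. exact: monalg.mcoeffD. Qed.

Lemma tensorP (u w : tensor) : (forall m, tcoef m u = tcoef m w) <-> u = w.
Proof. exact: monalg.malgP. Qed.

Fact tscaleA a b u : tscale a (tscale b u) = tscale (a * b) u.
Proof. by apply/tensorP => m; rewrite !tscaleE scalerA. Qed.
Fact tscale1 : left_id 1 tscale.
Proof. by move=> u; apply/tensorP => m; rewrite tscaleE scale1r. Qed.
Fact tscaleDr : right_distributive tscale +%R.
Proof.
by move=> a u w; apply/tensorP => m; rewrite tscaleE !tcoef_is_additive !tscaleE scalerDr.
Qed.
Fact tscaleDl u : {morph tscale^~ u : a b / a + b}.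
Proof.
by move=> a b; apply/tensorP => m; rewrite tcoef_is_additive !tscaleE scalerDl.
Qed.
HB.instance Definition _ :=
  GRing.Zmodule_isLmodule.Build C tensor tscaleA tscale1 tscaleDr tscaleDl.

Lemma tcoefZ m a (u : tensor) : tcoef m (a *: u) = a *: tcoef m u.
Proof. exact: tscaleE. Qed.

Lemma tcoefD m (u w : tensor) : tcoef m (u + w) = tcoef m u + tcoef m w.
Proof. exact: tcoef_is_additive. Qed.

Fact tcoef_is_linear m : linear (tcoef m).
Proof. by move=> a u w; rewrite tcoefD tcoefZ. Qed.
HB.instance Definition _ m := GRing.isLinear.Build C tensor M _ (tcoef m) (tcoef_is_linear m).

End Tensor.

HB.lock Definition tens (C : numClosedFieldType) (N : nat) (M : lmodType C)
    (v : M) (P : mpoly N C) : tensor N M :=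
  \sum_(m <- msupp P) (mkmalgU m (P@_m *: v) : tensor N M).

Section TensorMaps.
Variables (C : numClosedFieldType) (N : nat) (M : lmodType C).
Local Notation oscillator := (mpoly N C).
Local Notation tensor := (tensor N M).
Implicit Types u w : tensor.

(* The linear map on the tensor product induced by a bilinear map *)
Definition tlift (W : lmodType C) (phi : M -> oscillator -> W) (u : tensor) : W :=
  \sum_(m <- tsupp u) phi (tcoef m u) 'X_[m].

Definition optens (A : M -> M) (B : oscillator -> oscillator) : tensor -> tensor :=
  tlift (fun v P => tens (A v) (B P)).

Definition tform (f : M -> M -> C) (u w : tensor) : C :=
  \sum_(m <- tsupp u) \sum_(m' <- tsupp w)
    f (tcoef m u) (tcoef m' w) * bargmann_fock 'X_[m] 'X_[m'].

Lemma tcoef_tens m (v : M) (P : oscillator) : tcoef m (tens v P) = P@_m *: v.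
Proof.
rewrite unlock linear_sum /=.
under eq_bigr => m' _ do rewrite /tcoef monalg.mcoeffU.
case: (boolP (m \in msupp P)) => mP.
  rewrite (bigD1_seq m) ?msupp_uniq //= eqxx big1 ?addr0 // => m' /negbTE->.
  by [].
rewrite (memN_msupp_eq0 mP) scale0r big1_seq // => m' /andP[_ m'P].
by case: eqP => // em; rewrite -em m'P in mP.
Qed.

Lemma tcoef_out m (u : tensor) : m \notin tsupp u -> tcoef m u = 0.
Proof. exact: monalg.mcoeff_outdom. Qed.

Lemma tliftw (W : lmodType C) (phi : M -> oscillator -> W) (u : tensor) (s : seq 'X_{1..N}) :
  (forall P, phi 0 P = 0) -> uniq s -> {subset tsupp u <= s} ->
  tlift phi u = \sum_(m <- s) phi (tcoef m u) 'X_[m].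
Proof.
move=> phi0 us sub.
rewrite [RHS](bigID (mem (tsupp u))) /= [X in _ + X]big1 ?addr0; last first.
  by move=> m mu; rewrite tcoef_out.
rewrite -big_filter /tlift; apply: perm_big; apply: uniq_perm.
- exact: fset_uniq.
- exact: filter_uniq.
by move=> m; rewrite mem_filter; case: (boolP (m \in tsupp u)) => // /sub->.
Qed.

Section Lift.
Variables (W : lmodType C) (phi : M -> oscillator -> W).
Hypothesis phil : forall P, linear (phi^~ P).
Hypothesis phir : forall v, linear (phi v).

Let phi0 P : phi 0 P = 0.
Proof. by have := phil P (-1) 0 0; rewrite !scaleN1r oppr0 addr0 addNr. Qed.

Lemma tlift_is_linear : linear (tlift phi).
Proof.
move=> a u w; pose s := (tsupp u `|` tsupp w `|` tsupp (a *: u + w)%R)%fset.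
have us : uniq s by exact: fset_uniq.
rewrite (@tliftw _ _ (a *: u + w) s) // => [|m]; last by rewrite !inE => ->; rewrite orbT.
rewrite (@tliftw _ _ u s) // => [|m]; last by rewrite !inE => ->.
rewrite (@tliftw _ _ w s) // => [|m]; last by rewrite !inE => ->; rewrite orbT.
rewrite scaler_sumr -big_split /=; apply: eq_bigr => m _.
by rewrite linearP phil.
Qed.

Lemma tlift_tens v P : tlift phi (tens v P) = phi v P.
Proof.
rewrite (@tliftw _ _ _ (msupp P)) ?msupp_uniq //; last first.
  move=> m; apply: contraLR => mP; rewrite -monalg.mcoeff_eq0.
  by rewrite -/(tcoef m _) tcoef_tens (memN_msupp_eq0 mP) scale0r.
pose psi := phi v.
pose psiL := GRing.isLinear.Build C _ _ _ psi (phir v).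
pose psi' : {linear oscillator -> W} := HB.pack psi psiL.
rewrite [in RHS](mpolyE P) -[phi v]/(psi' : _ -> _) linear_sum /=.
apply: eq_bigr => m _; rewrite tcoef_tens.
transitivity (P@_m *: phi v 'X_[m]); last by symmetry; exact: (linearZZ psi').
by have := phil 'X_[m] P@_m v 0; rewrite !addr0 phi0 addr0.
Qed.
End Lift.

Lemma tens_linearl (P : oscillator) : linear (fun v : M => tens v P).
Proof.
move=> a v w; apply/tensorP => m.
by rewrite tcoefD tcoefZ !tcoef_tens scalerDr !scalerA mulrC.
Qed.

Lemma tens_linearr (v : M) : linear (fun P : oscillator => tens v P).
Proof.
move=> a P Q; apply/tensorP => m.
by rewrite tcoefD tcoefZ !tcoef_tens mcoeffD mcoeffZ scalerDl scalerA.
Qed.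

Lemma tensor_span (u : tensor) : u = \sum_(m <- tsupp u) tens (tcoef m u) 'X_[m].
Proof.
apply/tensorP => m; rewrite linear_sum /=.
under eq_bigr => m' _ do rewrite tcoef_tens mcoeffX.
case: (boolP (m \in tsupp u)) => mu.
  rewrite (bigD1_seq m) ?fset_uniq //= eqxx scale1r big1 ?addr0 // => m' /negbTE->.
  by rewrite scale0r.
rewrite (tcoef_out mu) big1_seq // => m' /andP[_ m'u].
by case: eqP => [em|_]; [rewrite -em m'u in mu|rewrite scale0r].
Qed.

Lemma optens_tens (A : {linear M -> M}) (B : {linear oscillator -> oscillator}) v P :
  optens A B (tens v P) = tens (A v) (B P).
Proof.
rewrite /optens tlift_tens // => [Q|w] a x y.
  by rewrite (linearP A) tens_linearl.
by rewrite (linearP B) tens_linearr.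
Qed.

Definition mfact (m : 'X_{1..N}) : C := (\prod_(i < N) (m i)`!)%:R.

Lemma mfact_gt0 m : 0 < mfact m.
Proof. by rewrite ltr0n prodn_gt0 // => i; exact: fact_gt0. Qed.

Lemma bargmann_fockX m m' :
  bargmann_fock 'X_[m] 'X_[m'] = (m == m')%:R * mfact m.
Proof.
rewrite /bargmann_fock msuppX big_seq1 !mcoeffX eqxx mul1r eq_sym.
by rewrite [RHS]mulrC; case: eqP; rewrite ?conjC1 ?conjC0 ?mul1r ?mulr1 ?mul0r ?mulr0.
Qed.

Section Form.
Variable f : {dot M for Num.conj}.

Lemma tformE u w (s : seq 'X_{1..N}) : uniq s -> {subset tsupp u <= s} ->
  tform f u w = \sum_(m <- s) f (tcoef m u) (tcoef m w) * mfact m.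
Proof.
move=> us sub; transitivity (\sum_(m <- tsupp u) f (tcoef m u) (tcoef m w) * mfact m).
  apply: eq_bigr => m _.
  under eq_bigr => m' _ do rewrite bargmann_fockX.
  case: (boolP (m \in tsupp w)) => mw.
    rewrite (bigD1_seq m) ?fset_uniq //= eqxx mul1r big1 ?addr0 // => m' /negbTE.
    by rewrite eq_sym => ->; rewrite mul0r mulr0.
  rewrite (tcoef_out mw) linear0r mul0r big1_seq // => m' /andP[_ m'w].
  by case: eqP => [em|_]; [rewrite em m'w in mw|rewrite mul0r mulr0].
rewrite [RHS](bigID (fun m => m \in tsupp u)) /= [X in _ + X]big1 ?addr0; last first.
  by move=> m mu; rewrite (tcoef_out mu) linear0l mul0r.
rewrite -[RHS]big_filter; apply: perm_big; apply: uniq_perm.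
- exact: fset_uniq.
- exact: filter_uniq.
by move=> m; rewrite mem_filter; case: (boolP (m \in tsupp u)) => // /sub->.
Qed.

Lemma tform_tens (v w : M) (P Q : oscillator) :
  tform f (tens v P) (tens w Q) = f v w * bargmann_fock P Q.
Proof.
rewrite (@tformE _ _ (msupp P)) ?msupp_uniq //; last first.
  move=> m; apply: contraLR => mP; rewrite -monalg.mcoeff_eq0.
  by rewrite -/(tcoef m _) tcoef_tens (memN_msupp_eq0 mP) scale0r.
rewrite mulr_sumr; apply: eq_bigr => m _.
rewrite !tcoef_tens linearZl_LR linearZr_LR /= -/(mfact m).
by rewrite !mulrA; congr (_ * _); rewrite [RHS]mulrC mulrA mulrC !mulrA; congr (_ * _); rewrite mulrC.
Qed.

Lemma tform_gt0 u : u != 0 -> 0 < tform f u u.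
Proof.
move=> u0; rewrite (@tformE _ _ (tsupp u)) ?fset_uniq //.
have fge0 v : 0 <= f v v.
  have [->|v0] := eqVneq v 0; first by rewrite linear0l.
  exact/ltW/neq0_dnorm_gt0.
have [m mu] : exists m, tcoef m u != 0.
  case: (boolP [exists m : tsupp u, tcoef (fsval m) u != 0]) => [/existsP[m]|].
    by exists (fsval m).
  rewrite negb_exists => /forallP all0; case/negP: u0; apply/eqP/tensorP => m.
  rewrite linear0; case: (boolP (m \in tsupp u)) => [mu|/tcoef_out//].
  by have := all0 [` mu]%fset; rewrite negbK => /eqP.
have ms : m \in tsupp u by apply: contraNT mu => /tcoef_out->.
rewrite (bigD1_seq m) ?fset_uniq //= ltr_pwDl //.
  by rewrite mulr_gt0 ?mfact_gt0 // neq0_dnorm_gt0.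
by apply: sumr_ge0 => m' _; rewrite mulr_ge0 // ltW // mfact_gt0.
Qed.

Lemma tformBr u w w' : tform f u (w - w') = tform f u w - tform f u w'.
Proof.
rewrite !(@tformE u _ (tsupp u)) ?fset_uniq // -sumrB; apply: eq_bigr => m _.
by rewrite -scaleN1r addrC tcoefD tcoefZ scaleN1r addrC linearBr mulrBl.
Qed.
End Form.
End TensorMaps.

Definition is_adjoint (C : numClosedFieldType) (T : Type) (form : T -> T -> C)
    (A B : T -> T) : Prop :=
  forall u w, form (A u) w = form u (B w).

Lemma adjoint_unique (C : numClosedFieldType) (N : nat) (M : lmodType C)
    (f : {dot M for Num.conj}) (A B B' : tensor N M -> tensor N M) :
  is_adjoint (tform f) A B -> is_adjoint (tform f) A B' -> B =1 B'.
Proof.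
move=> adB adB' w; apply/eqP; rewrite -subr_eq0.
by apply: contraT => /(tform_gt0 f); rewrite tformBr -adB -adB' subrr ltxx.
Qed.

Definition psd (C : numClosedFieldType) (T : Type) (form : T -> T -> C) (A : T -> T) :=
  forall u, 0 <= form (A u) u.
Definition nsd (C : numClosedFieldType) (T : Type) (form : T -> T -> C) (A : T -> T) :=
  forall u, form (A u) u <= 0.

(* d i and x i act on M through rho, and on C[x_1, .., x_N] as the derivation
   with respect to the i-th variable and the multiplication by it. *)
Definition dirac (C : numClosedFieldType) (g : superLie C) (M : lmodType C) (N : nat)
    (rho : g -> {linear M -> M}) (d x : 'I_N -> g) (u : tensor N M) : tensor N M :=
  2%:R *: \sum_(i < N) (optens (rho (d i)) (fun P => 'X_i * P) u
                        - optens (rho (x i)) (mderiv i) u).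

(* Main.v *)
(* On a monomial, multiplication by x_i and differentiation in x_i are adjoint
   for the Bargmann-Fock form, while unitarity turns omega(x_i) = eps d_i into
   rho(d_i)^* = eps rho(x_i) and rho(x_i)^* = eps rho(d_i).  Taking adjoints thus
   exchanges, up to the factor eps, the two terms of each summand
   d_i (x) x_i - x_i (x) d_i of D, so D^* = - eps D.  Then
   <D^2 u, u> = - eps <D u, D u>, whose sign is that of - eps. *)
From HB Require Import structures.
Require Import Defs.
From mathcomp Require Import all_boot all_order all_algebra.
From mathcomp Require Import finmap mpoly.
From mathcomp Require Import complex sesquilinear reals.
Import GRing.Theory Num.Theory.
Local Open Scope ring_scope.

(** * Sesquilinearity and positivity of the form on the tensor product *)

Section TensorForm.
Set Implicit Arguments.
Variables (C : numClosedFieldType) (N : nat) (M : lmodType C).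
Variable f : {dot M for Num.conj}.
Implicit Types u v w : tensor N M.

Lemma tformPl (a : C) u v w :
  tform f (a *: u + v) w = a * tform f u w + tform f v w.
Proof.
(* One index set containing the three supports, so that the sums compare termwise. *)
pose s := (tsupp u `|` tsupp v `|` tsupp (a *: u + v)%R)%fset.
rewrite !(@tformE _ _ _ f _ w s) ?fset_uniq //; last 3 first.
- by move=> m; rewrite !inE => ->; rewrite orbT.
- by move=> m; rewrite !inE => ->.
- by move=> m; rewrite !inE => ->; rewrite orbT.
rewrite mulr_sumr -big_split /=; apply: eq_bigr => m _.
by rewrite tcoefD tcoefZ linearPl /= mulrDl mulrA.
Qed.

Lemma tformPr (a : C) u v w :
  tform f u (a *: v + w) = a^* * tform f u v + tform f u w.
Proof.
rewrite !(@tformE _ _ _ f u _ (tsupp u)) ?fset_uniq //.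
rewrite mulr_sumr -big_split /=; apply: eq_bigr => m _.
by rewrite tcoefD tcoefZ linearPr /= mulrDl mulrA.
Qed.

(** Packaged as an instance to make the generic lemmas on sums, differences and scalars available
    for [tform]. *)
Fact tform_is_bilinear :
  bilinear_for (GRing.Scale.Law.clone _ _ ( *%R ) _)
    (GRing.Scale.Law.clone _ _ (Num.conj \; *%R ) _) (@tform C N M f).
Proof. by split=> [w a u v|u a v w]; [apply: tformPl|apply: tformPr]. Qed.

HB.instance Definition _ :=
  bilinear_isBilinear.Build C _ _ _
    (GRing.Scale.Law.clone _ _ ( *%R ) _)
    (GRing.Scale.Law.clone _ _ (Num.conj \; *%R ) _)
    (@tform C N M f) tform_is_bilinear.

Lemma tform_ge0 u : 0 <= tform f u u.
Proof.
have [->|u0] := eqVneq u 0; first by rewrite linear0l.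
exact/Order.POrderTheory.ltW/tform_gt0.
Qed.

(** [optens] is by definition a sum over the monomials of its argument; expanding the other argument
    by [tensor_span] reduces the claim to vectors tensored with monomials. *)
Lemma tform_optens (c : C) (A A' : M -> M) (B B' : mpoly N C -> mpoly N C) u w :
  (forall v v' : M, f (A v) v' = c * f v (A' v')) ->
  (forall m m', bargmann_fock (B 'X_[m]) 'X_[m'] = bargmann_fock 'X_[m] (B' 'X_[m'])) ->
  tform f (optens A B u) w = c * tform f u (optens A' B' w).
Proof.
move=> adA adB; rewrite [in LHS](tensor_span w) [in RHS](tensor_span u).
rewrite /optens /tlift !linear_sumlz mulr_sumr; apply: eq_bigr => m _.
rewrite !linear_sumr mulr_sumr; apply: eq_bigr => m' _.
by rewrite /= !tform_tens adA adB mulrA.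
Qed.

End TensorForm.

(** * Multiplication and differentiation in the oscillator module *)

Section Oscillator.
Set Implicit Arguments.
Variables (C : numClosedFieldType) (N : nat).
Implicit Types (i : 'I_N) (m : 'X_{1..N}).

Lemma mfact_addU i m : mfact C (U_(i) + m)%MM = (m i).+1%:R * mfact C m.
Proof.
rewrite /mfact (bigD1 i) //= [in RHS](bigD1 i) //= mnmDE mnm1E eqxx add1n factS.
rewrite -natrM mulnA; congr (_ * _)%:R; apply: eq_bigr => j ji.
by rewrite mnmDE mnm1E eq_sym (negbTE ji).
Qed.

(** The scalar produced by differentiating a monomial is an exponent, hence natural and fixed by
    conjugation. *)
Lemma bargmann_fockZl (n : nat) (P Q : mpoly N C) :
  bargmann_fock (n%:R *: P) Q = n%:R * bargmann_fock P Q.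
Proof.
case: n => [|n]; first by rewrite scale0r mul0r /bargmann_fock msupp0 big_nil.
rewrite /bargmann_fock (perm_big _ (msuppZ _ _)) ?pnatr_eq0 // mulr_sumr.
by apply: eq_bigr => m _; rewrite mcoeffZ !mulrA.
Qed.

Lemma bargmann_fockZr (n : nat) (P Q : mpoly N C) :
  bargmann_fock P (n%:R *: Q) = n%:R * bargmann_fock P Q.
Proof.
rewrite /bargmann_fock mulr_sumr; apply: eq_bigr => m _.
by rewrite mcoeffZ rmorphM /= conjC_nat mulrCA !mulrA.
Qed.

(** Both sides vanish unless [m'] is [U_(i) + m]; then both are the exponent of x_i in [m'] times
    [mfact C m]. *)
Lemma bargmann_fock_mulX i m m' :
  bargmann_fock ('X_i * 'X_[m]) 'X_[m'] = bargmann_fock 'X_[m] (mderiv i 'X_[m']) :> C.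
Proof.
rewrite -mpolyXD mderivX bargmann_fockZr !bargmann_fockX.
(* Subtraction of exponents is truncated, so exponent 0 is treated apart: there the derivative
   vanishes and x_i does not divide ['X_[m']]. *)
case: (eqVneq (m' i) 0%N) => [m'i0|m'i].
  rewrite m'i0 mul0r; case: eqP => [/mnmP/(_ i)|]; last by rewrite mul0r.
  by rewrite mnmDE mnm1E eqxx m'i0.
have Um' : (m' - U_(i) + U_(i))%MM = m' by rewrite submK // lep1mP.
rewrite -[in LHS]Um' [(m' - _ + _)%MM]addmC eqm_add2l.
case: eqP => [e|]; last by rewrite !mul0r mulr0.
by rewrite !mul1r mfact_addU -Um' -e mnmDE mnm1E eqxx addn1.
Qed.

(** The form is symmetric on monomials, so this is [bargmann_fock_mulX] with the arguments
    exchanged. *)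
Lemma bargmann_fock_mderiv i m m' :
  bargmann_fock (mderiv i 'X_[m]) 'X_[m'] = bargmann_fock 'X_[m] ('X_i * 'X_[m']) :> C.
Proof.
have sym m1 m2 : bargmann_fock 'X_[m1] 'X_[m2] = bargmann_fock 'X_[m2] 'X_[m1] :> C.
  by rewrite !bargmann_fockX; case: eqVneq => [->|]; rewrite ?eqxx ?mul0r.
rewrite -mpolyXD [RHS]sym mpolyXD bargmann_fock_mulX mderivX.
by rewrite bargmann_fockZl bargmann_fockZr sym.
Qed.

End Oscillator.

(** * Membership of the odd bases in the superalgebra *)

Section Carriers.
Set Implicit Arguments.
Variable C : numClosedFieldType.

Lemma sl_addr_closed m n :
  addr_closed [pred X : 'M[C]_(m + n) | supertrace X == 0].
Proof.
split=> [|X Y]; rewrite !inE /supertrace /ulsubmx /drsubmx; first by rewrite !linear0 subrr.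
by move=> /eqP X0 /eqP Y0; rewrite !linearD /= opprD addrACA X0 Y0 addr0.
Qed.

Lemma osp_addr_closed m n :
  addr_closed [pred X : 'M[C]_(m + (n + n)) |
    [&& ulsubmx X == - (ulsubmx X)^T,
        drsubmx X == Omega C n *m (drsubmx X)^T *m Omega C n
      & dlsubmx X == - (Omega C n *m (ursubmx X)^T)]].
Proof.
split=> [|X Y]; rewrite !inE /ulsubmx /ursubmx /dlsubmx /drsubmx.
  by rewrite !linear0 mul0mx !eqxx.
move=> /and3P[/eqP X1 /eqP X2 /eqP X3] /and3P[/eqP Y1 /eqP Y2 /eqP Y3].
by rewrite !linearD /= mulmxDl -X1 -X2 -X3 -Y1 -Y2 -Y3 !eqxx.
Qed.

Lemma F4_addr_closed : addr_closed (@F4_mem C).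
Proof.
split=> [|X Y]; rewrite !inE /=.
  by rewrite !linear0 !eqxx.
move=> /andP[/eqP X1 /eqP X2] /andP[/eqP Y1 /eqP Y2].
by rewrite !linearD /= X1 X2 Y1 Y2 addr0 !eqxx.
Qed.

Lemma lsa_addr_closed k : addr_closed (carrier (lsa C k)).
Proof.
case: k => [m n|n|m n|]; [exact: sl_addr_closed|by []|exact: osp_addr_closed|].
exact: F4_addr_closed.
Qed.

(** A finite sum of root vectors stays in the carrier, the domain on which unitarity and the
    linearity of [rho] and [om] are assumed. *)
Lemma n_odd_carrier (k : lsa_kind) (h : lsa C k -> Prop)
    (P : weight C h -> Prop) b X : n_odd P b X -> X \in carrier (lsa C k).
Proof.
have [g0 gD] := lsa_addr_closed k; case=> s [-> sub].
rewrite big_seq; elim/big_ind: _ => [//|//|Y /sub[a [_ _]]].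
by case: b {sub} => -[].
Qed.

Lemma is_basis_mem (g : superLie C) (V : g -> Prop) (N : nat)
    (e : 'I_N -> g) i : is_basis V e -> V (e i).
Proof. by case=> _ VE; apply/VE/memv_span/mapP; exists i; rewrite ?mem_enum. Qed.

End Carriers.

(** * Adjointness of the Dirac operator *)

Section Adjoint.
Set Implicit Arguments.
Variables (C : numClosedFieldType) (g : superLie C) (om : g -> g).
Variables (N : nat) (d x : 'I_N -> g) (eps : C).
Variables (M : lmodType C) (M0 M1 : {pred M}) (rho : g -> {linear M -> M}).
Variable f : {dot M for Num.conj}.
Hypotheses (om_inv : anti_involution om) (eps_sign : eps = 1 \/ eps = -1).
Hypotheses (d_carrier : forall i, d i \in carrier g)
           (x_carrier : forall i, x i \in carrier g)
           (om_x : forall i, om (x i) = eps *: d i).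
Hypotheses (rho_rep : is_representation M0 M1 rho) (f_unitary : unitary om M0 M1 rho f).

Let conj_eps : eps^* = eps.
Proof. by case: eps_sign => ->; rewrite ?rmorphN rmorph1. Qed.

Let eps_sq : eps * eps = 1.
Proof. by case: eps_sign => ->; rewrite ?mulrNN mulr1. Qed.

Let scale_subr1 (V : lmodType C) (v : V) : eps *: v = (eps - 1) *: v + v.
Proof. by rewrite scalerBl scale1r subrK. Qed.

(* A linearity hypothesis of the shape [F (a *: X + Y)] is used with Y := X, so that
   0 need not lie in the carrier. *)
Lemma rho_scale X v : X \in carrier g -> rho (eps *: X) v = eps *: rho X v.
Proof.
have [_ rhoP _ _] := rho_rep => gX.
by rewrite !scale_subr1 rhoP.
Qed.

Lemma om_scale X : X \in carrier g -> om (eps *: X) = eps *: om X.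
Proof.
have [_ omP _ _] := om_inv => gX.
by rewrite !scale_subr1 omP // rmorphB rmorph1 /= conj_eps.
Qed.

(** Apply the involution [om] to [om (x i) = eps *: d i]; [eps] is real with square 1. *)
Lemma om_d i : om (d i) = eps *: x i.
Proof.
have [_ _ /(_ _ (x_carrier i))[_ omK] _] := om_inv.
by rewrite -[in RHS]omK om_x om_scale // scalerA eps_sq scale1r.
Qed.

Lemma rho_d_adjoint i v w : f (rho (d i) v) w = eps * f v (rho (x i) w).
Proof.
have [_ fP] := f_unitary.
by rewrite fP // om_d rho_scale // linearZr_LR /= conj_eps.
Qed.

Lemma rho_x_adjoint i v w : f (rho (x i) v) w = eps * f v (rho (d i) w).
Proof.
have [_ fP] := f_unitary.
by rewrite fP // om_x rho_scale // linearZr_LR /= conj_eps.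
Qed.

Lemma dirac_adjoint u w :
  tform f (dirac rho d x u) w = - eps * tform f u (dirac rho d x w).
Proof.
rewrite /dirac linearZl_LR linearZr_LR /= conjC_nat mulrCA; congr (_ * _).
rewrite linear_sumlz linear_sumr mulr_sumr; apply: eq_bigr => i _.
(* The sign of [- eps] reverses the difference on the right, so that each term faces its adjoint
   partner. *)
rewrite linearBl linearBr mulNr -mulrN opprB mulrBr; congr (_ - _).
  by apply: tform_optens; [exact: rho_d_adjoint|exact: bargmann_fock_mulX].
by apply: tform_optens; [exact: rho_x_adjoint|exact: bargmann_fock_mderiv].
Qed.

(** Moving [- eps] into the second argument conjugates it, and [eps] is real. *)
Lemma dirac_is_adjoint :
  is_adjoint (tform f) (dirac rho d x) (fun u : tensor N M => - eps *: dirac rho d x u).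
Proof.
by move=> u w; rewrite dirac_adjoint [RHS]linearZr_LR /= rmorphN /= conj_eps.
Qed.

End Adjoint.

Theorem theorem35
  (R : realType) (k : lsa_kind) (om : lsa R[i] k -> lsa R[i] k)
  (h : lsa R[i] k -> Prop) (P0 P : weight R[i] h -> Prop)
  (eps : R[i]) (N : nat) (d x : 'I_N -> lsa R[i] k)
  (M : lmodType R[i]) (M0 M1 : {pred M}) (rho : lsa R[i] k -> {linear M -> M})
  (f : {dot M for Num.conj}) :
  admissible k ->
  anti_involution om ->
  real_form_type om ->
  even_setting om P0 ->
  positive_system h P ->
  extends_even h P0 P ->
  eps = 1 \/ eps = -1 ->
  adapted_bases h om P eps d x ->
  is_representation M0 M1 rho ->
  highest_weight h P rho ->
  unitary om M0 M1 rho f ->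
  let D := dirac rho d x in
  let form := tform (N := N) f in
  [/\ is_adjoint form D (fun u => - eps *: D u),
      eps = -1 -> is_adjoint form D D,
      eps = 1 -> is_adjoint form D (fun u => - D u),
      eps = -1 -> psd form (fun u => D (D u))
    & eps = 1 -> nsd form (fun u => D (D u))].
Proof.
move=> _ om_inv _ _ _ _ eps_sign [d_basis x_basis _ om_x] rho_rep _ f_unitary D form.
have d_carrier i : d i \in carrier (lsa _ k).
  by apply: n_odd_carrier (is_basis_mem i d_basis).
have x_carrier i : x i \in carrier (lsa _ k).
  by apply: n_odd_carrier (is_basis_mem i x_basis).
have adD : is_adjoint form D (fun u => - eps *: D u).
  exact: (dirac_is_adjoint _ _ om_inv eps_sign d_carrier x_carrier om_x rho_rep f_unitary).
(* For the square, [adD] moves the outer [D] across, leaving plus or minus the form of [D u] with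
   itself. *)
split=> // e u => [w|w||]; rewrite adD e ?opprK ?scale1r ?scaleN1r //.
- exact: tform_ge0.
- by rewrite [X in X <= 0]linearNr oppr_le0 tform_ge0.
Qed.
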